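(* Let $(X,r)$ be a finite left non-degenerate idempotent set-theoretic solution of the Yang--Baxter equation. Let $S=S(X,r)$ and $\Lambda=\Lambda(X,r)$. For $u\in\Lambda$ put \[S_u=\{(a,\lambda_a)\in S:\lambda_a^{-1}(a)=|a|u\}.\] Then: \begin{enumerate} \item each $S_u$ is a cancellative subsemigroup of $S$; \item $S=\bigcup_{u\in\Lambda}S_u$, a disjoint union; \item $S_u\circ S_v\subseteq S_v$ for all $u,v\in\Lambda$; \item if $s,t\in S$ and $u\in\Lambda$, then $s\circ t\in S_u$ if and only if $t\in S_u$. \end{enumerate} In particular, equipping $\Lambda$ with the band structure given by $uv=v$, the semigroup $S$ is a band graded semigroup (graded by $\Lambda$) whose homogeneous components $S_u$ are cancellative semigroups.
   Context: A set-theoretic solution of the Yang--Baxter equation is a pair $(X,r)$ with $X$ a non-empty set and $r\colon X\times X\to X\times X$ a map satisfying $(r\times\mathrm{id})(\mathrm{id}\times r)(r\times\mathrm{id})=(\mathrm{id}\times r)(r\times\mathrm{id})(\mathrm{id}\times r)$. Write $r(x,y)=(\lambda_x(y),\rho_y(x))$. It is finite if $X$ is finite, left non-degenerate if every $\lambda_x\colon X\to X$ is bijective, and idempotent if $r^2=r$. The diagonal map is $q\colon X\to X$, $q(x)=\lambda_x^{-1}(x)$, and $\Lambda=\Lambda(X,r)=q(X)$. The structure monoid is $M=M(X,r)=\langle X\mid x\circ y=\lambda_x(y)\circ\rho_y(x),\ x,y\in X\rangle$ and the structure semigroup is $S=S(X,r)=M\setminus\{1\}$. For $(X,r)$ left non-degenerate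 and idempotent, the derived structure monoid is $A=A(X,r)=\langle X\mid x+y=y+y,\ x,y\in X\rangle$ (written additively); every non-zero element is uniquely of the form $nx$ with $n\ge1$, $x\in X$, one has $nx+my=(n+m)y$ for $m\ge1$, and its length is $|nx|=n$. Each $\lambda_x$ extends to an automorphism of $A$, and this yields a monoid homomorphism $\lambda\colon(M,\circ)\to\mathrm{Aut}(A,+)$, $m\mapsto\lambda_m$. There is a bijection $\pi\colon M\to A$ with $\pi(x)=x$ for $x\in X$ and $\pi(m\circ m')=\pi(m)+\lambda_m(\pi(m'))$. For $a\in A$ write $\lambda_a=\lambda_{\pi^{-1}(a)}$. Identify $m\in M$ with $(\pi(m),\lambda_m)\in A\rtimes\mathrm{Aut}(A,+)$; thus $M=\{(a,\lambda_a):a\in A\}$, $S=\{(a,\lambda_a):0\neq a\in A\}$, the generator $x\in X$ is $(x,\lambda_x)$, and $(a,\lambda_a)\circ(b,\lambda_b)=(a+\lambda_a(b),\lambda_a\lambda_b)$ with $\lambda_{a+\lambda_a(b)}=\lambda_a\lambda_b$. A band is a semigroup all of whose elements are idempotent. A semigroup $S$ is graded by a band $\Lambda$ if $S=\bigcup_{u\in\Lambda}S_u$ is a disjoint union of non-empty subsets with $S_uS_v\subseteq S_{uv}$ for all $u,v\in\Lambda$. *)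

(* Defs.v *)
From HB Require Import structures.
From mathcomp Require Import all_boot.
From mathcomp Require Import generic_quotient.
From mathcomp Require Import boolp classical_sets functions.

Set Implicit Arguments.
Unset Strict Implicit.
Unset Printing Implicit Defensive.
Import Algebra.

Local Open Scope classical_set_scope.
Local Open Scope quotient_scope.

Section Solutions.
Variables (X : Type) (r : X * X -> X * X).

Definition lam (x y : X) : X := (r (x, y)).1.
Definition rho (y x : X) : X := (r (x, y)).2.

Definition r_id (t : X * X * X) : X * X * X := (r t.1, t.2).
Definition id_r (t : X * X * X) : X * X * X :=
  let: (x, y, z) := t in (x, (r (y, z)).1, (r (y, z)).2).

Definition yang_baxter : Prop :=
  r_id \o id_r \o r_id =1 id_r \o r_id \o id_r.

Definition left_nondegenerate : Prop := forall x, bijective (lam x).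

(* ['pinv_id [set: T] f] is the two-sided inverse of [f] whenever
   [f : T -> T] is bijective. *)
Definition diag (x : X) : X := 'pinv_id [set: X] (lam x) x.

Definition Lambda : set X := range diag.

End Solutions.

Lemma pinvT_K (T : Type) (f : T -> T) :
  bijective f -> cancel f ('pinv_id [set: T] f).
Proof.
by move=> /bij_inj fI x; apply: (@pinvKV _ _ id setT f); rewrite ?inE // => ? ? _ _ /fI.
Qed.

Lemma pinvT_KV (T : Type) (f : T -> T) :
  bijective f -> cancel ('pinv_id [set: T] f) f.
Proof.
by move=> fB; have [g fK gK] := fB => x; rewrite -{1}(gK x) pinvT_K.
Qed.

Section Presentation.
Variables (X : choiceType) (R : seq X -> seq X -> Prop).

(* The congruence on the free monoid [seq X] generated by [R]; the monoid
   < X | R > is the quotient [presented]. *)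
Inductive cong : seq X -> seq X -> Prop :=
| cong_rel p u v s : R u v -> cong (p ++ u ++ s) (p ++ v ++ s)
| cong_refl u : cong u u
| cong_sym u v : cong u v -> cong v u
| cong_trans v u w : cong u v -> cong v w -> cong u w.

Lemma cong_cat p s u v : cong u v -> cong (p ++ u ++ s) (p ++ v ++ s).
Proof.
elim=> {u v} [p' u v s' Ruv|u|u v _|v u w _ uv _]; last exact: cong_trans.
- by have := cong_rel (p ++ p') (s' ++ s) Ruv; rewrite -!catA.
- exact: cong_refl.
- exact: cong_sym.
Qed.

Definition congb : rel (seq X) := fun u v => `[< cong u v >].

Lemma congb_refl : reflexive congb.
Proof. by move=> u; apply/asboolP/cong_refl. Qed.
Lemma congb_sym : symmetric congb.
Proof. by move=> u v; apply/asboolP/asboolP => /cong_sym. Qed.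
Lemma congb_trans : transitive congb.
Proof. by move=> v u w /asboolP uv /asboolP vw; apply/asboolP/(cong_trans uv). Qed.

Canonical congb_equiv := EquivRel congb congb_refl congb_sym congb_trans.

Definition presented := {eq_quot congb}.
HB.instance Definition _ := Choice.on presented.
HB.instance Definition _ := Quotient.on presented.
HB.instance Definition _ := EqQuotient.on presented.

Definition cls (w : seq X) : presented := \pi_presented w.

Lemma clsP u v : cls u = cls v <-> cong u v.
Proof.
by split=> [/eqmodP/asboolP|uv] //; apply/eqmodP/asboolP.
Qed.

Lemma cong_repr w : cong (repr (cls w)) w.
Proof. by apply/clsP; rewrite /cls reprK. Qed.

Lemma cls_ind (P : presented -> Prop) : (forall w, P (cls w)) -> forall m, P m.
Proof. by move=> Pc m; rewrite -[m]reprK; apply: Pc. Qed.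

Definition pmul (a b : presented) : presented := cls (repr a ++ repr b).

Lemma pmul_cls u v : pmul (cls u) (cls v) = cls (u ++ v).
Proof.
apply/clsP; apply: (@cong_trans (u ++ repr (cls v))).
  by have := cong_cat [::] (repr (cls v)) (cong_repr u).
by have := cong_cat u [::] (cong_repr v); rewrite !cats0.
Qed.

Lemma pmulA : associative pmul.
Proof.
elim/cls_ind=> u; elim/cls_ind=> v; elim/cls_ind=> w.
by rewrite !pmul_cls catA.
Qed.

Lemma pmul1 : left_id (cls [::]) pmul.
Proof. by elim/cls_ind=> u; rewrite pmul_cls. Qed.

Lemma pmulr1 : right_id (cls [::]) pmul.
Proof. by elim/cls_ind=> u; rewrite pmul_cls cats0. Qed.

Hypothesis R_size : forall u v, R u v -> size u = size v.

Lemma cong_size u v : cong u v -> size u = size v.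
Proof.
elim=> {u v} [p u v s /R_size uv||//|v u w _ -> //] //.
by rewrite !size_cat uv.
Qed.

End Presentation.

Section StructureMonoid.
Variables (X : choiceType) (r : X * X -> X * X).

Definition struct_rel (u v : seq X) : Prop :=
  exists x y, u = [:: x; y] /\ v = [:: lam r x y; rho r y x].

Definition struct_monoid := presented struct_rel.
HB.instance Definition _ := Choice.on struct_monoid.
HB.instance Definition _ := Quotient.on struct_monoid.
HB.instance Definition _ :=
  isMonoid.Build struct_monoid
    (@pmulA _ struct_rel) (@pmul1 _ struct_rel) (@pmulr1 _ struct_rel).

Definition genM (x : X) : struct_monoid := cls struct_rel [:: x].

Definition nontrivial : {pred struct_monoid} := fun m => (m != 1)%g.

Lemma struct_rel_size u v : struct_rel u v -> size u = size v.
Proof. by case=> x [y [-> ->]]. Qed.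

Lemma nontrivial_mulg_closed : mulg_closed nontrivial.
Proof.
elim/cls_ind=> u; elim/cls_ind=> v; rewrite !unfold_in => u1 _.
apply: contra_neq u1; rewrite [(_ * _)%g]pmul_cls => /clsP/(cong_size struct_rel_size).
by case: u.
Qed.

Definition struct_semigroup := {m : struct_monoid | nontrivial m}.
HB.instance Definition _ := Choice.on struct_semigroup.
HB.instance Definition _ := SubType.on struct_semigroup.
HB.instance Definition _ :=
  SubChoice_isSubSemigroup.Build _ _ struct_semigroup nontrivial_mulg_closed.

End StructureMonoid.

Section DerivedMonoid.
Variable X : choiceType.

Definition derived_rel (u v : seq X) : Prop :=
  exists x y, u = [:: x; y] /\ v = [:: y; y].

(* [+] on A is not commutative, so A is only declared as a
   [baseAddUMagmaType]; this provides [a + b], [0] and [a *+ n].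
   Its monoid laws are [addA_A], [add0_A] and [addr0_A]. *)
Definition derived_monoid := presented derived_rel.
HB.instance Definition _ := Choice.on derived_monoid.
HB.instance Definition _ := Quotient.on derived_monoid.
HB.instance Definition _ :=
  hasAdd.Build derived_monoid (@pmul _ derived_rel).
HB.instance Definition _ := hasZero.Build derived_monoid (cls derived_rel [::]).

Definition genA (x : X) : derived_monoid := cls derived_rel [:: x].

Local Open Scope ring_scope.

Lemma addA_A : associative (fun a b : derived_monoid => a + b).
Proof. exact: pmulA. Qed.
Lemma add0_A : left_id 0 (fun a b : derived_monoid => a + b).
Proof. exact: pmul1. Qed.
Lemma addr0_A : right_id 0 (fun a b : derived_monoid => a + b).
Proof. exact: pmulr1. Qed.

(* All words representing an element have the same size, see [lenA_cls]. *)
Definition lenA (a : derived_monoid) : nat := size (repr a).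

Lemma derived_rel_size u v : derived_rel u v -> size u = size v.
Proof. by case=> x [y [-> ->]]. Qed.

Lemma lenA_cls w : lenA (cls derived_rel w) = size w.
Proof. exact: (cong_size derived_rel_size (cong_repr _ w)). Qed.

(* The endomorphism of A extending [f]. *)
Definition mapA (f : X -> X) (a : derived_monoid) : derived_monoid :=
  cls derived_rel [seq f y | y <- repr a].

Lemma mapA_cls f w : mapA f (cls derived_rel w) = cls derived_rel (map f w).
Proof.
apply/clsP; move: (cong_repr derived_rel w); move: (repr _) => u'.
elim=> {u' w}.
- move=> p u v s [y [z [-> ->]]]; rewrite !map_cat /=.
  by apply: (@cong_rel _ _ _ [:: f y; f z] [:: f z; f z]); exists (f y), (f z).
- by move=> u; apply: cong_refl.
- by move=> u v _; apply: cong_sym.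
- by move=> u v w _ + _; apply: cong_trans.
Qed.

Lemma mapAD f (a b : derived_monoid) : mapA f (a + b) = mapA f a + mapA f b.
Proof.
elim/cls_ind: a => u; elim/cls_ind: b => v.
by rewrite [_ + _]pmul_cls !mapA_cls [RHS]pmul_cls map_cat.
Qed.

End DerivedMonoid.

Section LambdaPi.
Variables (X : choiceType) (r : X * X -> X * X).
Local Open Scope ring_scope.
Local Notation M := (struct_monoid r).
Local Notation A := (derived_monoid X).
Local Notation clsM := (cls (struct_rel r)).
Local Notation clsA := (cls (@derived_rel X)).

(* The extension of [lam r x] to A. *)
Definition lamX (x : X) : A -> A := mapA (lam r x).

(* lambda_(x1 o ... o xn) = lambda_x1 ... lambda_xn. *)
Definition lamW (w : seq X) (a : A) : A := foldr lamX a w.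

Definition lamM (m : M) : A -> A := lamW (repr m).

(* pi (x o m) = x + lambda_x (pi m). *)
Definition piW (w : seq X) : A := foldr (fun x a => genA x + lamX x a) 0 w.

Definition piM (m : M) : A := piW (repr m).

(* When [r] is a left non-degenerate idempotent solution, [lamM] and [piM] do
   not depend on the choice of representatives ([lamM_cls], [piM_cls]), [lamM]
   is a monoid homomorphism from M to Aut(A) ([lamM_nmod_morphism], [lamM_bij],
   [lamM1], [lamM_mul]), and [piM] is the bijection from M to A determined by
   [piM_gen] and [piM_mul] ([piM_bij]). *)

Lemma lamX_cls x w : lamX x (clsA w) = clsA [seq lam r x y | y <- w].
Proof. exact: mapA_cls. Qed.

Lemma lamXD x a b : lamX x (a + b) = lamX x a + lamX x b.
Proof. exact: mapAD. Qed.

Lemma lamX0 x : lamX x 0 = 0.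
Proof. by rewrite [0]/(clsA [::]) lamX_cls. Qed.

Lemma lamWD w a b : lamW w (a + b) = lamW w a + lamW w b.
Proof. by elim: w => //= x w ->; rewrite lamXD. Qed.

Lemma lamM_nmod_morphism m : nmod_morphism (lamM m).
Proof.
split=> [|a b]; last exact: lamWD.
by rewrite /lamM; elim: (repr m) => //= x w ->; rewrite lamX0.
Qed.

Lemma genA_absorb (x y : X) : genA x + genA y = genA y + genA y.
Proof.
rewrite /genA ![_ + _]pmul_cls; apply/clsP.
by apply: (@cong_rel _ _ [::] [:: x; y] [:: y; y] [::]); exists x, y.
Qed.

Hypotheses (rYB : yang_baxter r) (rL : left_nondegenerate r)
  (rI : idempotent_fun r).

Lemma lam_lam x y z :
  lam r x (lam r y z) = lam r (lam r x y) (lam r (rho r y x) z).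
Proof.
have /(congr1 (fun t => t.1.1)) := rYB (x, y, z).
by rewrite /= /r_id /id_r /lam /rho /=; case: (r (x, y)) => a b /=;
  case: (r (x, _)).
Qed.

Lemma lam_rho x y : lam r (lam r x y) (rho r y x) = lam r x y.
Proof.
by have := rI (x, y); rewrite /lam /rho /=; case: (r (x, y)) => a b /= ->.
Qed.

Lemma lamX_lamX x y a :
  lamX x (lamX y a) = lamX (lam r x y) (lamX (rho r y x) a).
Proof.
elim/cls_ind: a => w; rewrite !lamX_cls -!map_comp.
by congr cls; apply: eq_map => z; apply: lam_lam.
Qed.

Lemma lamM_cls w : lamM (clsM w) = lamW w.
Proof.
apply/funext => a; rewrite /lamM.
move: (cong_repr (struct_rel r) w); move: (repr _) => u'.
elim=> {u' w} //= [p u v s|u v w _ -> //].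
case=> x [y [-> ->]]; rewrite /lamW !foldr_cat /=; congr foldr.
exact: lamX_lamX.
Qed.

Lemma piM_cls w : piM (clsM w) = piW w.
Proof.
rewrite /piM.
move: (cong_repr (struct_rel r) w); move: (repr _) => u'.
elim=> {u' w} //= [p u v s|u v w _ -> //].
case=> x [y [-> ->]]; rewrite /piW !foldr_cat /=; congr foldr.
rewrite !lamXD lamX_lamX !addA_A; congr (_ + _).
by rewrite !lamX_cls /= lam_rho genA_absorb.
Qed.

Lemma lamM_gen x y : lamM (genM r x) (genA y) = genA (lam r x y).
Proof. by rewrite lamM_cls /= lamX_cls. Qed.

Lemma lamM1 : lamM 1%g =1 id.
Proof. by move=> a; rewrite [1%g]/(clsM [::]) lamM_cls. Qed.

Lemma lamM_mul m m' : lamM (m * m')%g =1 lamM m \o lamM m'.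
Proof.
move=> a; elim/cls_ind: m => u; elim/cls_ind: m' => v.
by rewrite [(_ * _)%g]pmul_cls /= !lamM_cls /lamW foldr_cat.
Qed.

Lemma lamX_bij x : bijective (lamX x).
Proof.
have [g fK gK] := rL x.
by exists (mapA g); elim/cls_ind=> w; rewrite /lamX !mapA_cls -map_comp;
  congr cls; rewrite -[RHS]map_id; apply: eq_map => y /=; rewrite ?fK ?gK.
Qed.

Lemma lamM_bij m : bijective (lamM m).
Proof.
rewrite /lamM; elim: (repr m) => [|x w IH]; first by exists id.
exact: (bij_comp (lamX_bij x) IH).
Qed.

Lemma piM_gen x : piM (genM r x) = genA x.
Proof. by rewrite piM_cls /= lamX0 addr0_A. Qed.

Lemma piM_mul m m' : piM (m * m')%g = piM m + lamM m (piM m').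
Proof.
elim/cls_ind: m => u; elim/cls_ind: m' => v.
rewrite [(_ * _)%g]pmul_cls !piM_cls lamM_cls /piW foldr_cat -!/(piW _).
elim: u => [|x u /= ->]; first by rewrite add0_A.
by rewrite lamXD addA_A.
Qed.

Definition actM (m : M) (x : X) : X := foldr (lam r) x (repr m).

Lemma lamM_genA m x : lamM m (genA x) = genA (actM m x).
Proof.
by rewrite /lamM /actM; elim: (repr m) => //= y w ->; rewrite lamX_cls.
Qed.

Lemma actM_bij m : bijective (actM m).
Proof.
rewrite /actM; elim: (repr m) => [|x w IH]; first by exists id.
exact: (bij_comp (rL x) IH).
Qed.

Lemma actM_cls w x : actM (clsM w) x = foldr (lam r) x w.
Proof.
rewrite /actM.
move: (cong_repr (struct_rel r) w); move: (repr _) => u'.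
elim=> {u' w} //= [p u v s|u v w _ -> //].
by case=> y [z [-> ->]]; rewrite !foldr_cat /=; congr foldr; apply: lam_lam.
Qed.

Lemma actM_mulgen m x y : actM (m * genM r x)%g y = actM m (lam r x y).
Proof.
elim/cls_ind: m => w.
by rewrite [(_ * _)%g]pmul_cls !actM_cls foldr_cat.
Qed.

(* The inverse of [piM]: if it sends a to m then it sends a + z to
   m o lambda_m^-1(z). *)
Definition piV_step (m : M) (z : X) : M :=
  (m * genM r ('pinv_id [set: X] (actM m) z))%g.

Definition piVW (w : seq X) : M := foldl piV_step 1%g w.

Lemma piV_step_act m x : piV_step m (actM m x) = (m * genM r x)%g.
Proof. by rewrite /piV_step pinvT_K //; apply: actM_bij. Qed.

Lemma actM_surj m z : exists x, z = actM m x.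
Proof. by have [g _ gK] := actM_bij m; exists (g z). Qed.

Lemma genM_rel x y :
  (genM r x * genM r y = genM r (lam r x y) * genM r (rho r y x))%g.
Proof.
rewrite [LHS]pmul_cls [RHS]pmul_cls; apply/clsP.
apply: (@cong_rel _ _ [::] [:: x; y] [:: lam r x y; rho r y x] [::]).
by exists x, y.
Qed.

Lemma piV_step_rel m x y :
  piV_step (piV_step m x) y = piV_step (piV_step m y) y.
Proof.
have [x' ->] := actM_surj m x; have [t ->] := actM_surj m y.
rewrite !piV_step_act.
have [g _ lamK] := rL x'; rewrite -(lamK t); move: (g t) => {}t.
rewrite -[in LHS]actM_mulgen piV_step_act -[in X in _ = piV_step _ X](lam_rho x' t).
by rewrite -actM_mulgen piV_step_act -!mulgA genM_rel.
Qed.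

Lemma piVW_cong u v : cong (@derived_rel X) u v -> piVW u = piVW v.
Proof.
elim=> {u v} //= [p u v s|u v w _ -> //].
case=> x [y [-> ->]]; rewrite /piVW !foldl_cat /=; congr foldl.
exact: piV_step_rel.
Qed.

Lemma piVW_add (a : A) z :
  piVW (repr (a + genA z)) = piV_step (piVW (repr a)) z.
Proof.
elim/cls_ind: a => w; rewrite [_ + _]pmul_cls (piVW_cong (cong_repr _ _)).
by rewrite (piVW_cong (cong_repr _ w)) /piVW foldl_cat.
Qed.

Lemma piVW_piM m : piVW (repr (piM m)) = m.
Proof.
elim/cls_ind: m; elim/last_ind=> [|w x IH].
  by rewrite piM_cls -[RHS]/(piVW [::]); apply/piVW_cong/cong_repr.
have -> : clsM (rcons w x) = ((clsM w : M) * genM r x)%g.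
  by rewrite [RHS]pmul_cls cats1.
by rewrite piM_mul piM_gen lamM_genA piVW_add IH piV_step_act.
Qed.

Lemma piM_piVW w : piM (piVW w) = clsA w.
Proof.
elim/last_ind: w => [|w z IH]; first by rewrite /piVW /= piM_cls.
rewrite /piVW foldl_rcons -/(piVW w) /piV_step piM_mul piM_gen lamM_genA.
by rewrite pinvT_KV ?IH; [rewrite [LHS]pmul_cls cats1 | apply: actM_bij].
Qed.

Lemma piM_bij : bijective piM.
Proof.
exists (fun a => piVW (repr a)); first exact: piVW_piM.
by move=> a; rewrite piM_piVW /cls reprK.
Qed.

End LambdaPi.

Section Semigroups.
Local Open Scope group_scope.

Definition subsemigroup (S : semigroupType) (T : set S) : Prop :=
  T !=set0 /\ forall s t, T s -> T t -> T (s * t).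

Definition cancellative (S : semigroupType) (T : set S) : Prop :=
  forall s t t', T s -> T t -> T t' ->
    (s * t = s * t' -> t = t') /\ (t * s = t' * s -> t = t').

Definition band (B : semigroupType) : Prop := forall u : B, u * u = u.

Definition band_graded (B S : semigroupType) (C : B -> set S) : Prop :=
  [/\ band B,
      forall u, C u !=set0,
      \bigcup_u C u = [set: S],
      trivIset [set: B] C
    & forall u v, [set s * t | s in C u & t in C v] `<=` C (u * v)].

End Semigroups.

Section Components.
Variables (X : choiceType) (r : X * X -> X * X).

(* Lambda as a type, with the multiplication u * v = v. *)
Definition Lambda_band := set_type (Lambda r).
HB.instance Definition _ := Choice.on Lambda_band.

Definition Lambda_mul (u v : Lambda_band) : Lambda_band := v.

Lemma Lambda_mulA : associative Lambda_mul. Proof. by []. Qed.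

HB.instance Definition _ := isSemigroup.Build Lambda_band Lambda_mulA.

(* S_u. The element s of S is the pair (a, lambda_a) with a = piM s and
   lambda_a = lamM s; this is an identification by [piM_bij], [piM_mul] and
   [lamM_mul]. The inverse of [lamM s] is genuine by [lamM_bij]. *)
Definition S_comp (u : X) : set (struct_semigroup r) :=
  [set s | 'pinv_id [set: derived_monoid X] (lamM (val s)) (piM (val s))
           = (genA u *+ lenA (piM (val s)))%R].

End Components.

Arguments S_comp {X} r u.

(* Main.v *)
Require Import Defs.
From mathcomp Require Import all_boot.
From mathcomp Require Import boolp classical_sets functions.

(** Every s in S is a product m o x with x in X, and then
    pi(s) = |s| lambda_m(x), so lambda_s^-1(pi(s)) = |s| lambda_x^-1(x) = |s| q(x).
    Hence s lies in S_u exactly for u = q(x), where x is the last letter of any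
    word representing s; the decomposition and the grading follow.
    An element s of S_u satisfies pi(s) = |s| lambda_s(u), so it is determined
    by the length |s| and the permutation lambda_s of X. Thus S_u embeds into
    the cancellative monoid N x Sym(X). *)

Local Open Scope classical_set_scope.
Local Open Scope group_scope.

Section Derived.
Set Implicit Arguments.
Unset Strict Implicit.
Variable X : choiceType.
Local Notation clsA := (cls (@derived_rel X)).
Local Open Scope ring_scope.

(** Both sides of a defining relation [x + y = y + y] end in [y]. The parameter [x] is only the
    default for the empty word. *)
Lemma cong_last (x : X) u v : cong (@derived_rel X) u v -> last x u = last x v.
Proof.
elim=> {u v} [p u v s [y [z [-> ->]]]|//|//|v u w _ -> //].
by rewrite !last_cat.
Qed.

Lemma genA_mulrn (x : X) n : genA x *+ n = clsA (nseq n x).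
Proof.
have S k : genA x *+ k.+1 = clsA (nseq k.+1 x); last by case: n => //.
elim: k => [//|k IH].
by rewrite -[LHS]/(genA x + genA x *+ k.+1) IH [LHS]pmul_cls.
Qed.

(** The last letter of any representing word recovers [x]; a positive multiple is required, since
    all zero multiples coincide. *)
Lemma genA_mulrn_inj (x y : X) n :
  genA x *+ n.+1 = genA y *+ n.+1 -> x = y.
Proof.
rewrite !genA_mulrn => /clsP/(cong_last x) /=.
by rewrite -!/(nseq n _); elim: n.
Qed.

Lemma lenAD (a b : derived_monoid X) : lenA (a + b) = (lenA a + lenA b)%N.
Proof.
elim/cls_ind: a => u; elim/cls_ind: b => v.
by rewrite [_ + _]pmul_cls !lenA_cls size_cat.
Qed.

Lemma lenA_mapA (f : X -> X) (a : derived_monoid X) : lenA (mapA f a) = lenA a.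
Proof. by elim/cls_ind: a => u; rewrite mapA_cls !lenA_cls size_map. Qed.

(** A final [x] turns the letter before it into [x], and this propagates to the left through the
    whole word. *)
Lemma addA_genA (a : derived_monoid X) (x : X) :
  a + genA x = genA x *+ (lenA a).+1.
Proof.
elim/cls_ind: a => u; rewrite genA_mulrn lenA_cls [LHS]pmul_cls.
elim: u => [//|y u IH]; apply/clsP.
apply: (@cong_trans _ _ (y :: nseq (size u).+1 x)).
  by have /clsP/(cong_cat [:: y] [::]) := IH; rewrite !cats0.
apply: (@cong_rel _ _ [::] [:: y; x] [:: x; x] (nseq (size u) x)).
by exists y, x.
Qed.

End Derived.

Section Components.
Set Implicit Arguments.
Unset Strict Implicit.
Variables (X : choiceType) (r : X * X -> X * X).
Hypotheses (rYB : yang_baxter r) (rL : left_nondegenerate r)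
  (rI : idempotent_fun r).
Local Notation S := (struct_semigroup r).

Lemma lenA_lamM (m : struct_monoid r) a : lenA (lamM m a) = lenA a.
Proof. by rewrite /lamM; elim: (repr m) => //= x w <-; rewrite lenA_mapA. Qed.

(** With [actM_mul] this makes length and action on X a homomorphism from M to N x Sym(X). *)
Lemma lenA_piM_mul (m m' : struct_monoid r) :
  lenA (piM (m * m')) = (lenA (piM m) + lenA (piM m'))%N.
Proof. by rewrite piM_mul // lenAD lenA_lamM. Qed.

Lemma actM_mul (m m' : struct_monoid r) x :
  actM (m * m') x = actM m (actM m' x).
Proof.
elim/cls_ind: m => u; elim/cls_ind: m' => v.
by rewrite [(_ * _)%g]pmul_cls !actM_cls // foldr_cat.
Qed.

Lemma lamM_genA_mulrn (m : struct_monoid r) x n :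
  (lamM m (genA x *+ n) = genA (actM m x) *+ n)%R.
Proof.
have [lam0 lamD] := lamM_nmod_morphism m.
have S k : (lamM m (genA x *+ k.+1) = genA (actM m x) *+ k.+1)%R.
  elim: k => [|k IH]; first exact: lamM_genA.
  by rewrite -[in LHS]/(genA x + genA x *+ k.+1)%R lamD IH lamM_genA.
by case: n.
Qed.

Lemma struct_semigroup_last (s : S) :
  exists m x, val s = (m * genM r x)%g.
Proof.
have := valP s; elim/cls_ind: (val s) => w; case/lastP: w => [|w x _].
  by rewrite /nontrivial eqxx.
by exists (cls _ w), x; rewrite [RHS]pmul_cls cats1.
Qed.

(** Applying the bijection [lamM (val s)] to both sides removes the inverse from the definition of
    [S_comp]. *)
Lemma S_compE u (s : S) :
  S_comp r u s <->
  (piM (val s) = genA (actM (val s) u) *+ lenA (piM (val s)))%R.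
Proof.
have lB := lamM_bij rL (val s); rewrite -lamM_genA_mulrn /S_comp /=.
by split=> [<-|{1}->]; rewrite ?pinvT_KV ?pinvT_K.
Qed.

Lemma lam_diag x : lam r x (diag r x) = x.
Proof. exact: pinvT_KV. Qed.

Lemma S_comp_last u (s : S) m x :
  val s = (m * genM r x)%g -> S_comp r u s <-> diag r x = u.
Proof.
move=> sE; rewrite S_compE sE actM_mulgen // piM_mul // piM_gen //.
rewrite lamM_genA addA_genA genA_mulrn lenA_cls size_nseq -genA_mulrn.
(* Both sides are now the same positive multiple of a generator; cancelling it and [actM m] leaves
   [x = lam r x u], that is, [u = diag r x]. *)
split=> [/genA_mulrn_inj/(bij_inj (actM_bij rL m)) xE|<-].
  by rewrite [in LHS]/diag {2}xE pinvT_K.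
by rewrite lam_diag.
Qed.

(** A word for [s * t] can be chosen with the same last letter as a word for [t]. *)
Lemma S_comp_mul u (s t : S) : S_comp r u (s * t) <-> S_comp r u t.
Proof.
have [m [x tE]] := struct_semigroup_last t.
have stE : val (s * t) = ((val s * m) * genM r x)%g by rewrite -mulgA -tE.
by rewrite (S_comp_last u stE) (S_comp_last u tE).
Qed.

Lemma genM_nontrivial x : nontrivial (genM r x).
Proof.
by apply/eqP => /clsP/(cong_size (@struct_rel_size _ r)).
Qed.

Lemma S_comp_neq0 u : Lambda r u -> S_comp r u !=set0.
Proof.
case=> x _ xu; exists (Sub (genM r x) (genM_nontrivial x)).
(* If [u = diag r x], the generator [x] itself is the witness, with trivial prefix. *)
by apply/(@S_comp_last _ _ 1%g x); rewrite // SubK mul1g.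
Qed.

Lemma S_comp_cover (s : S) : exists2 u, Lambda r u & S_comp r u s.
Proof.
have [m [x sE]] := struct_semigroup_last s.
by exists (diag r x); [exists x | apply/(S_comp_last _ sE)].
Qed.

Lemma S_comp_inj u v (s : S) : S_comp r u s -> S_comp r v s -> u = v.
Proof.
have [m [x sE]] := struct_semigroup_last s.
by move=> /(S_comp_last _ sE) <- /(S_comp_last _ sE).
Qed.

Lemma S_comp_subsemigroup u : Lambda r u -> subsemigroup (S_comp r u).
Proof.
by move=> /S_comp_neq0 ?; split=> // s t _ ut; apply/S_comp_mul.
Qed.

Lemma S_comp_eq u (s t : S) : S_comp r u s -> S_comp r u t ->
  lenA (piM (val s)) = lenA (piM (val t)) ->
  actM (val s) =1 actM (val t) -> s = t.
Proof.
move=> /S_compE us /S_compE ut len_st act_st; apply/val_inj.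
by apply: (bij_inj (piM_bij rYB rL rI)); rewrite us ut len_st act_st.
Qed.

Lemma S_comp_cancellative u : cancellative (S_comp r u).
Proof.
move=> s t t' _ ut ut'; split=> /(congr1 val); rewrite /= => st.
  apply: (S_comp_eq ut ut').
    by have := congr1 (fun m => lenA (piM m)) st;
      rewrite /= !lenA_piM_mul => /addnI.
  (* Left cancellation uses that [actM (val s)] is injective. *)
  move=> x; apply: (bij_inj (actM_bij rL (val s))).
  by rewrite -!actM_mul st.
apply: (S_comp_eq ut ut').
  by have := congr1 (fun m => lenA (piM m)) st;
    rewrite /= !lenA_piM_mul => /addIn.
(* Right cancellation uses that it is surjective: the actions of [t] and [t'] need only be compared
   on its image. *)
move=> x; have [y ->] := actM_surj rL (val s) x.
by rewrite -!actM_mul st.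
Qed.

End Components.

Theorem proposition3p2 (X : finType) (r : X * X -> X * X)
    (X_neq0 : 0 < #|X|) (r_YB : yang_baxter r)
    (r_lnd : left_nondegenerate r) (r_idem : idempotent_fun r) :
  [/\ forall u : X, Lambda r u ->
        subsemigroup (S_comp r u) /\ cancellative (S_comp r u),
      \bigcup_(u in Lambda r) S_comp r u = [set: struct_semigroup r] /\
        trivIset (Lambda r) (S_comp r),
      forall u v : X, Lambda r u -> Lambda r v ->
        [set s * t | s in S_comp r u & t in S_comp r v] `<=` S_comp r v
    & forall (s t : struct_semigroup r) (u : X), Lambda r u ->
        S_comp r u (s * t) <-> S_comp r u t] /\
  [/\ forall u v : Lambda_band r, u * v = v,
      band_graded (fun u : Lambda_band r => S_comp r (val u))
    & forall u : Lambda_band r,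
        subsemigroup (S_comp r (val u)) /\ cancellative (S_comp r (val u))].
Proof.
have comp u : Lambda r u ->
    subsemigroup (S_comp r u) /\ cancellative (S_comp r u).
  by move=> Lu; split; [exact: S_comp_subsemigroup | exact: S_comp_cancellative].
have mul u v :
    [set s * t | s in S_comp r u & t in S_comp r v] `<=` S_comp r v.
  by move=> _ [s _ [t vt <-]]; apply/S_comp_mul.
have LbP (u : Lambda_band r) : Lambda r (val u) by exact: set_valP.
split; split=> //.
- split; first by apply/seteqP; split=> // s _; apply: S_comp_cover.
  by move=> u v _ _ [s [us vs]]; apply: S_comp_inj us vs.
- by move=> s t u _; apply: S_comp_mul.
- split=> //.
  + by move=> u; apply: S_comp_neq0.
  + apply/seteqP; split=> // s _.
    have [u Lu us] := S_comp_cover r_YB r_lnd r_idem s.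
    by exists (SigSub (mem_set Lu) : Lambda_band r).
  + by move=> u v _ _ [s [us vs]]; apply/val_inj; apply: S_comp_inj us vs.
- by move=> u; apply: comp.
Qed.
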